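(* Let $G=(V,E)$ be a finite simple connected graph. Let $F,F_0:\mathbb F_2^{V}\to \mathbb F_2^{V}$ be given by $F(s)=(1+s)(1+P_s)$ and $F_0(s)=sP_s$, where $P_s(v)=\prod_{x\in N(v)}(1+s(x))$ for $v\in V$, and let $\mathcal X_2=\{F,F_0\}$. Then $G$ has an idomatic-$2$-partition if and only if $\ell_{\mathcal X_2}(\mathbb F_2^V)$ contains a configuration other than $c_0$. If $s\in\ell_{\mathcal X_2}(\mathbb F_2^V)$ with $s\neq c_0$, then $\{s^{-1}(1),s^{-1}(0)\}$ is an idomatic-$2$-partition of $G$, and any idomatic-$2$-partition of $G$ is of this form for some $s\in\ell_{\mathcal X_2}(\mathbb F_2^V)$.
   Context: Graphs are undirected. $\mathbb F_2=\{0,1\}$ is the field with two elements and $\mathbb F_2^{V}$ is the set of functions (''configurations'') $V\to\mathbb F_2$, with pointwise addition and multiplication; $1$ denotes the constant function $1$ and $c_0$ the constant function $0$. $N(v)=\{x\in V : vx\in E\}$ is the open neighborhood of $v$; empty products equal $1$. A dominating set of $G$ is a subset $D\subseteq V$ such that every vertex not in $D$ is adjacent to a vertex in $D$. A subset of $V$ is independent if no two of its vertices are adjacent. An idomatic-$2$-partition of $G$ is a partition of $V$ into two disjoint sets, each of which is both independent and dominating. For $\mathcal X_2=\{F,F_0\}$, the free monoid $\mathcal F(a,b)$ on two generators acts on $\mathbb F_2^V$ by $a\cdot s=F(s)$, $b\cdot s=F_0(s)$, extended to words by composition (the empty word acts as the identity). $\mathrm{Orb}(s)=\{w\cdot s: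 w\in\mathcal F(a,b)\}$, and $\ell_{\mathcal X_2}(\mathbb F_2^V)$ is the set of all $s\in\mathbb F_2^V$ such that both $F$ and $F_0$ restrict to permutations of $\mathrm{Orb}(s)$. *)

(* Defs.v *)
From HB Require Import structures.
From mathcomp Require Import all_boot all_order all_algebra.
From mathcomp Require Import classical_sets functions.

Set Implicit Arguments.
Unset Strict Implicit.
Unset Printing Implicit Defensive.

Import GRing.Theory.
Local Open Scope ring_scope.

(* A finite simple graph is a symmetric irreflexive relation on a finType. *)

Section Graph.
Variables (V : finType) (e : rel V).
Implicit Types (D : {set V}) (P : {set {set V}}).

(* The empty graph is not connected. *)
Definition connected_graph : Prop :=
  (0 < #|V|)%N /\ forall x y : V, connect e x y.

Definition neighbors (v : V) : {set V} := [set x | e v x].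

Definition dominating D : bool :=
  [forall v, (v \notin D) ==> [exists x in D, e v x]].

Definition independent D : bool :=
  [forall x in D, forall y in D, ~~ e x y].

(* finset.partition excludes empty blocks, which are never dominating when V is
   nonempty. *)
Definition idomatic2 P : bool :=
  [&& finset.partition P [set: V], #|P| == 2%N
    & [forall D in P, independent D && dominating D]].

End Graph.

Section FreeMonoidAction.
Variables (S I : Type) (X : I -> S -> S).

(* Words of the free monoid on I are lists; the leftmost letter acts last, so
   that concatenation of words acts as composition. *)
Definition act (w : seq I) (s : S) : S := foldr X s w.

Definition Orb (s : S) : set S := [set act w s | w in setT]%classic.

Definition ell : set S :=
  [set s | forall i : I, set_bij (Orb s) (Orb s) (X i)]%classic.

End FreeMonoidAction.

(* Sums and products of configurations below are those of the ring
   {ffun V -> 'F_2}, which are pointwise; its 0 and 1 are the constant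
   configurations. *)
Section Maps.
Variables (V : finType) (e : rel V).

Definition Pconf (s : {ffun V -> 'F_2}) : {ffun V -> 'F_2} :=
  [ffun v => \prod_(x in neighbors e v) (1 + s x)].

Definition F (s : {ffun V -> 'F_2}) : {ffun V -> 'F_2} :=
  (1 + s) * (1 + Pconf s).

Definition F0 (s : {ffun V -> 'F_2}) : {ffun V -> 'F_2} := s * Pconf s.

Variant letter := La | Lb.

Definition X2 (i : letter) : {ffun V -> 'F_2} -> {ffun V -> 'F_2} :=
  match i with La => F | Lb => F0 end.

End Maps.

(* Main.v *)
(* As F0 o F0 = F0, injectivity on Orb(s) forces F0 = id there: every
   configuration t of the orbit is (the indicator of) an independent set, and
   F(t) is its neighborhood. If some vertex is isolated, then by connectedness
   the graph is edgeless, so F = 0 and surjectivity gives s = 0. Otherwise F o F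
   enlarges sets, and being onto the finite orbit it is the identity there.
   Hence, for s <> 0, the union of s and F(s) is nonempty and closed under
   adjacency, so it is V, i.e. F(s) = 1 + s. Conversely, the orbit of one side s
   of an idomatic partition is {s, 1 + s}, on which F and F0 are involutions. *)

Require Import Defs.
From HB Require Import structures.
From mathcomp Require Import all_boot all_order all_algebra.
From mathcomp Require Import classical_sets functions.

Set Implicit Arguments.
Unset Strict Implicit.
Unset Printing Implicit Defensive.

Import GRing.Theory.
Local Open Scope ring_scope.

(** * Configurations viewed as vertex sets *)

Definition supp (V : finType) (s : {ffun V -> 'F_2}) : {set V} :=
  [set v | s v != 0].

Lemma F2_cases (x : 'F_2) : x = 0 \/ x = 1.
Proof. by case: x => [[|[|[]]] //= lt_x]; [left|right]; apply: val_inj. Qed.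

Lemma F2_inj (x y : 'F_2) : (x != 0) = (y != 0) -> x = y.
Proof. by case: (F2_cases x) => ->; case: (F2_cases y) => ->. Qed.

Section Configurations.
Variables (V : finType) (e : rel V).
Implicit Types (s t : {ffun V -> 'F_2}) (A : {set V}).

Lemma in_supp s v : (v \in supp s) = (s v != 0).
Proof. by rewrite inE. Qed.

Lemma supp_inj : injective (@supp V).
Proof.
by move=> s t /setP st; apply/ffunP=> v; apply: F2_inj; rewrite -!in_supp st.
Qed.

Lemma supp0 : supp (0 : {ffun V -> 'F_2}) = finset.set0.
Proof. by apply/setP=> v; rewrite !inE ffunE eqxx. Qed.

Lemma supp_compl s : supp (1 + s) = ~: supp s.
Proof.
by apply/setP=> v; rewrite !inE !ffunE; case: (F2_cases (s v)) => ->.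
Qed.

Lemma preim1_supp s : s @^-1: [set 1] = supp s.
Proof. by apply/setP=> v; rewrite !inE; case: (F2_cases (s v)) => ->. Qed.

Lemma preim0_supp s : s @^-1: [set 0] = ~: supp s.
Proof. by apply/setP=> v; rewrite !inE negbK. Qed.

Lemma supp_surj A : exists s, supp s = A.
Proof.
exists [ffun v => (v \in A)%:R]; apply/setP=> v.
by rewrite in_supp ffunE; case: (v \in A).
Qed.

Lemma Pconf_neq0 s v :
  (Pconf e s v != 0) = ~~ [exists x, e v x && (x \in supp s)].
Proof.
rewrite ffunE negb_exists; apply/prodf_neq0/forallP => [Pv x | Pv x].
  apply/negP=> /andP[vx]; have := Pv x; rewrite !inE => /(_ vx).
  by case: (F2_cases (s x)) => ->.
rewrite inE => vx; have := Pv x; rewrite vx inE.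
by case: (F2_cases (s x)) => ->.
Qed.

Lemma in_F s v : (v \in supp (F e s)) =
  (v \notin supp s) && [exists x, e v x && (x \in supp s)].
Proof.
rewrite -[X in _ && X]negbK -Pconf_neq0 !in_supp /F ffunE.
have -> : (1 + s) v = 1 + s v by rewrite !ffunE.
have -> : (1 + Pconf e s) v = 1 + Pconf e s v.
  by rewrite ffunE [(1 : {ffun V -> 'F_2}) v]ffunE.
by case: (F2_cases (s v)) => ->; case: (F2_cases (Pconf e s v)) => ->.
Qed.

Lemma in_F0 s v : (v \in supp (F0 e s)) =
  (v \in supp s) && ~~ [exists x, e v x && (x \in supp s)].
Proof.
rewrite -Pconf_neq0 !in_supp /F0 ffunE.
by case: (F2_cases (s v)) => ->; case: (F2_cases (Pconf e s v)) => ->.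
Qed.

(** [F0] deletes from the support exactly the vertices with a neighbor in it; independence means
    that nothing is deleted. *)
Lemma independentE s : independent e (supp s) = (F0 e s == s).
Proof.
apply/forallP/eqP => [ind | <- v].
  apply/supp_inj/setP=> v; rewrite in_F0.
  case: (boolP (v \in supp s)) => //= vs; apply/existsP=> -[x /andP[vx xs]].
  by have := ind v; rewrite vs => /forallP/(_ x); rewrite xs vx.
apply/implyP; rewrite in_F0 => /andP[_ /existsPn noN].
apply/forallP=> x; apply/implyP; rewrite in_F0; have := noN x.
by case: (e v x) => //= /negbTE->.
Qed.

(** The support of [F e s] always lies in the complement of [supp s]; it fills the complement when
    every outside vertex has a neighbor inside. *)
Lemma dominatingE s : dominating e (supp s) = (F e s == 1 + s).
Proof.
apply/forallP/eqP => [dom | Fs v].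
  apply/supp_inj/setP=> v; rewrite in_F supp_compl finset.in_setC.
  have := dom v; case: (v \in supp s) => //= /existsP[x /andP[xs vx]].
  by apply/existsP; exists x; rewrite vx.
apply/implyP; rewrite -finset.in_setC -supp_compl -Fs in_F.
move=> /andP[_ /existsP[x /andP[vx xs]]].
by apply/existsP; exists x; rewrite xs.
Qed.

(** A vertex kept by [F0] has no neighbor in the support, hence none in the smaller support of
    [F0 e s]. *)
Lemma F0_idem s : F0 e (F0 e s) = F0 e s.
Proof.
apply/supp_inj/setP=> v; rewrite in_F0; apply: andb_idr.
rewrite in_F0 => /andP[_]; apply: contra => /existsP[x /andP[vx]].
by rewrite in_F0 => /andP[xs _]; apply/existsP; exists x; rewrite vx.
Qed.

Lemma dominating_neq0 A : (0 < #|V|)%N -> dominating e A -> A != finset.set0.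
Proof.
move=> /card_gt0P[v _] /forallP/(_ v); apply: contraTneq => ->.
by rewrite inE /=; apply/existsP=> -[x]; rewrite inE.
Qed.

Lemma idomatic2_compl A : (0 < #|V|)%N ->
  independent e A -> dominating e A ->
  independent e (~: A) -> dominating e (~: A) -> idomatic2 e [set A; ~: A].
Proof.
move=> V0 iA dA iC dC; apply/and3P; split.
- apply/and3P; split.
  + by rewrite /finset.cover finset.bigcup_setU !big_set1 finset.setUCr.
  + apply/finset.trivIsetP=> B C; rewrite !inE => /orP[]/eqP-> /orP[]/eqP->;
      by rewrite ?eqxx // => _; rewrite finset.disjoints_subset ?finset.setCK.
  + by rewrite !inE negb_or ![finset.set0 == _]eq_sym !dominating_neq0.
- rewrite cards2; case: (A =P ~: A) => // AC.
  have /finset.set0Pn[x xA] := dominating_neq0 V0 dA.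
  by have := xA; rewrite {1}AC inE xA.
- by apply/forallP=> B; apply/implyP; rewrite !inE => /orP[]/eqP->; apply/andP.
Qed.

Lemma idomatic2_inv (P : {set {set V}}) : idomatic2 e P -> exists A,
  [/\ P = [set A; ~: A], independent e A, dominating e A,
      independent e (~: A) & dominating e (~: A)].
Proof.
case/and3P=> /and3P[/eqP covP /finset.trivIsetP trP _].
move=> /cards2P[A [B [AB defP]]] /forallP PD.
have [AP BP] : A \in P /\ B \in P by rewrite defP !inE !eqxx orbT.
(* Disjointness of the blocks gives one inclusion, covering gives the other. *)
have defB : B = ~: A.
  apply/eqP; rewrite finset.eqEsubset -finset.disjoints_subset disjoint_sym.
  rewrite trP //=.
  apply/fintype.subsetP=> x; rewrite inE => xA.
  have : x \in finset.cover P by rewrite covP inE.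
  by rewrite defP /finset.cover finset.bigcup_setU !big_set1 inE (negbTE xA).
have /andP[iA dA] := implyP (PD A) AP; have /andP[iB dB] := implyP (PD B) BP.
by exists A; rewrite -defB.
Qed.

End Configurations.

(** * Orbits under an arbitrary family of self-maps *)

Section Orbits.
Variables (S I : Type) (X : I -> S -> S).

Lemma Orb_refl s : Orb X s s.
Proof. by exists [::]. Qed.

Lemma Orb_step s t i : Orb X s t -> Orb X s (X i t).
Proof. by case=> w _ <-; exists (i :: w). Qed.

Lemma Orb_ind (Q : S -> Prop) s : Q s -> (forall i t, Q t -> Q (X i t)) ->
  forall t, Orb X s t -> Q t.
Proof. by move=> Qs QX t [w _ <-]; elim: w => //= i w; apply: QX. Qed.

(** The orbit is stable under each [X i], which is then its own inverse there. *)
Lemma ell_involutive s :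
  (forall i t, Orb X s t -> X i (X i t) = t) -> ell X s.
Proof.
move=> XX i; split=> [t /= | t u | t /= st].
- exact: Orb_step.
- by rewrite !inE => st su Xtu; rewrite -(XX i t st) Xtu XX.
- by exists (X i t); [apply: Orb_step | apply: XX].
Qed.

Lemma ell_inj s i t u : ell X s -> Orb X s t -> Orb X s u ->
  X i t = X i u -> t = u.
Proof. by move=> /(_ i)[_ injX _] st su; apply: injX; rewrite inE. Qed.

Lemma ell_surj s i t : ell X s -> Orb X s t -> exists2 u, Orb X s u & X i u = t.
Proof. by move=> /(_ i)[_ _ surjX] /surjX[u]; exists u. Qed.

End Orbits.

(** * Recurrent configurations on a connected graph *)

Section Recurrent.
Variables (V : finType) (e : rel V).
Hypotheses (e_sym : symmetric e) (e_conn : connected_graph e).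
Implicit Types (s t : {ffun V -> 'F_2}).

Lemma ell_idomatic s :
  independent e (supp s) -> dominating e (supp s) ->
  independent e (~: supp s) -> dominating e (~: supp s) -> ell (X2 e) s.
Proof.
rewrite -supp_compl !independentE !dominatingE.
move=> /eqP F0s /eqP Fs /eqP F0c /eqP Fc.
have cc : 1 + (1 + s) = s.
  by apply: supp_inj; rewrite !supp_compl finset.setCK.
have orb t : Orb (X2 e) s t -> t = s \/ t = 1 + s.
  apply: (Orb_ind (Q := fun t => t = s \/ t = 1 + s)); first by left.
  by move=> [] u [] -> /=; rewrite ?Fs ?Fc ?cc ?F0s ?F0c; auto.
apply: ell_involutive => -[] t /orb[] -> /=.
- by rewrite Fs Fc.
- by rewrite Fc cc Fs.
- by rewrite !F0s.
- by rewrite !F0c.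
Qed.

Lemma F0_ell s t : ell (X2 e) s -> Orb (X2 e) s t -> F0 e t = t.
Proof.
move=> ells st; apply: (ell_inj (i := Lb) ells) => //; last exact: F0_idem.
exact: (Orb_step Lb).
Qed.

Lemma F_edgeless s : (forall x y, ~~ e x y) -> F e s = 0.
Proof.
move=> e0; apply/supp_inj/setP=> v; rewrite in_F supp0 finset.in_set0.
by apply/negP=> /andP[_ /existsP[x]]; rewrite (negbTE (e0 v x)).
Qed.

(** A path starting at [v] cannot take a first step, so by connectedness [v] is the only vertex. *)
Lemma isolated_edgeless v : (forall x, ~~ e v x) -> forall x y, ~~ e x y.
Proof.
move=> v0; have all_v x : x = v.
  have /connectP[[|y p] //= /andP[vy]] := e_conn.2 v x.
  by rewrite (negbTE (v0 y)) in vy.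
by move=> x y; rewrite (all_v x).
Qed.

Lemma ell_no_isolated s : ell (X2 e) s -> s <> 0 -> forall v, exists x, e v x.
Proof.
move=> ells s0 v; apply/existsP; apply: contra_notT s0 => /existsPn v0.
have [u _ <-] := ell_surj La ells (Orb_refl _ _).
exact/F_edgeless/isolated_edgeless/v0.
Qed.

(** Any neighbor [x] of a vertex [v] of the independent set [supp s] lies outside it, hence in
    [supp (F e s)]. As [v] is not in [supp (F e s)] but is adjacent to [x], the second [F] recovers
    it. *)
Lemma supp_sub_FF s : (forall v, exists x, e v x) -> F0 e s = s ->
  supp s \subset supp (F e (F e s)).
Proof.
move=> noiso F0s; apply/fintype.subsetP=> v vs; rewrite !in_F vs /=.
have [x vx] := noiso v; apply/existsP; exists x; rewrite vx in_F /=.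
have xs : x \notin supp s.
  move: vs; rewrite -{1}F0s in_F0 => /andP[_ /existsPn/(_ x)].
  by rewrite vx.
by rewrite xs; apply/existsP; exists v; rewrite e_sym vx.
Qed.

(* [F \o F] enlarges supports on the orbit and is onto it, so by induction on
   the size of the support it fixes every configuration of the orbit. *)
Lemma FF_ell s t : ell (X2 e) s -> s <> 0 -> Orb (X2 e) s t ->
  F e (F e t) = t.
Proof.
move=> ells s0; have noiso := ell_no_isolated ells s0.
have [n] := ubnP #|supp t|; elim: n t => // n IHn t ltn st.
have [u su Fu] := ell_surj La ells st.
have [w sw Fw] := ell_surj La ells su.
have FFw : F e (F e w) = t by rewrite -Fu -Fw.
have := supp_sub_FF noiso (F0_ell ells sw); rewrite FFw => sub_wt.
have [/supp_inj wt | wt] := eqVneq (supp w) (supp t); first by rewrite -{1}wt.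
have ltwt : (#|supp w| < #|supp t|)%N.
  by apply: proper_card; rewrite finset.properEneq wt.
have := IHn w (leq_trans ltwt ltn) sw.
by rewrite FFw => tw; rewrite tw eqxx in wt.
Qed.

Lemma F_compl_ell s : ell (X2 e) s -> s <> 0 -> F e s = 1 + s.
Proof.
move=> ells s0; have FFs := FF_ell ells s0 (Orb_refl _ _).
(* A neighbor of [supp s] lies in [supp s] or in [supp (F e s)]; a neighbor of [supp (F e s)] lies
   in it or in the support of [F e (F e s)], which is [s]. *)
have step x y : e x y -> x \in supp s :|: supp (F e s) ->
    y \in supp s :|: supp (F e s).
  rewrite e_sym !finset.in_setU => yx /orP[xs | xFs].
    rewrite in_F; case: (y \in supp s) => //=.
    by apply/existsP; exists x; rewrite yx.
  case: (boolP (y \in supp (F e s))) => [|yFs]; first by rewrite orbT.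
  by rewrite -{1}FFs in_F yFs orbF /=; apply/existsP; exists x; rewrite yx.
have clo := intro_closed (sym_connect_sym e_sym) step.
have /finset.set0Pn[x xs] : supp s != finset.set0.
  by apply/eqP; rewrite -supp0 => /supp_inj.
apply/supp_inj/setP=> v; rewrite supp_compl finset.in_setC.
(* Every [v] is connected to [x], so it lies in the union; [supp (F e s)] avoids [supp s] by [in_F],
   so it is the complement. *)
have := closed_connect clo (e_conn.2 x v); rewrite !finset.in_setU xs.
move=> /= /esym.
by rewrite in_F; case: (v \in supp s).
Qed.

Lemma idomatic2_ell s : ell (X2 e) s -> s <> 0 ->
  idomatic2 e [set s @^-1: [set 1]; s @^-1: [set 0]].
Proof.
move=> ells s0; rewrite preim1_supp preim0_supp.
have Fs := F_compl_ell ells s0.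
have sc : Orb (X2 e) s (1 + s).
  by rewrite -Fs; apply: (Orb_step La); apply: Orb_refl.
have cc : 1 + (1 + s) = s.
  by apply: supp_inj; rewrite !supp_compl finset.setCK.
(* Independence of the two sides is that [F0] fixes [s] and [1 + s], both in the orbit; domination
   is that [F] swaps them. *)
apply: idomatic2_compl e_conn.1 _ _ _ _;
  rewrite -?supp_compl ?independentE ?dominatingE.
- by rewrite (F0_ell ells) //; apply: Orb_refl.
- by rewrite Fs.
- by rewrite (F0_ell ells sc).
- by rewrite cc -{1}Fs (FF_ell ells s0) //; apply: Orb_refl.
Qed.

Lemma ell_of_idomatic2 (P : {set {set V}}) : idomatic2 e P ->
  exists s : {ffun V -> 'F_2},
    [/\ ell (X2 e) s, s <> 0 & P = [set s @^-1: [set 1]; s @^-1: [set 0]]].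
Proof.
case/idomatic2_inv=> A [-> iA dA iC dC].
have [s defA] := supp_surj A; exists s; rewrite preim1_supp preim0_supp defA.
split=> // [|s0]; first by apply: ell_idomatic; rewrite defA.
(* If [s] were zero, the dominating set [A] would be empty, although [V] is not. *)
by have := dominating_neq0 e_conn.1 dA; rewrite -defA s0 supp0 eqxx.
Qed.

End Recurrent.

Theorem corollary4p4 (V : finType) (e : rel V) (e_sym : symmetric e)
    (e_irr : irreflexive e) (e_conn : connected_graph e) :
  [/\ (exists P : {set {set V}}, idomatic2 e P) <->
        (exists s : {ffun V -> 'F_2}, ell (X2 e) s /\ s <> 0),
      forall s : {ffun V -> 'F_2}, ell (X2 e) s -> s <> 0 ->
        idomatic2 e [set s @^-1: [set 1]; s @^-1: [set 0]]
    & forall P : {set {set V}}, idomatic2 e P ->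
        exists s : {ffun V -> 'F_2},
          ell (X2 e) s /\ P = [set s @^-1: [set 1]; s @^-1: [set 0]]].
Proof.
split=> [|s|P /(ell_of_idomatic2 e_conn)[s [ells _ defP]]].
- split=> [[P /(ell_of_idomatic2 e_conn)[s [ells s0 _]]] | [s [ells s0]]].
    by exists s.
  by eexists; apply: idomatic2_ell ells s0.
- exact: idomatic2_ell.
- by exists s.
Qed.
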